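(* Let $0<\varepsilon,\delta\le \frac13$, let $n \ge C\cdot \frac{1}{\varepsilon}\log\frac{1}{\delta}$ for a sufficiently large absolute constant $C$, and fix a positive real number $r$. Then there exists a (randomized) algorithm taking as input $n$ points $x_1,\dots,x_n\in\mathbb{R}^d$ with the following guarantees: (1) The algorithm is $(\varepsilon,\delta)$-differentially private over arbitrary datasets $\{x_1,\dots,x_n\}$. (2) If there exists a ball of radius $r$, centered at some unknown point $x\in\mathbb{R}^d$, that contains at least $\frac23$ of the points $x_1,\dots,x_n$, then with probability $1$ the algorithm returns a point $x'\in\mathbb{R}^d$ such that $\|x'-x\|_2\le O(r\sqrt d)$.
   Context: Differential privacy (item-level): two datasets $(x_1,\dots,x_n)$ and $(x_1',\dots,x_n')$ are neighboring if they differ in exactly one point. A randomized algorithm $M$ is $(\varepsilon,\delta)$-differentially private if for every pair of neighboring datasets $X,X'$ and every measurable subset $S$ of the output space, $\mathbb{P}[M(X)\in S]\le e^{\varepsilon}\mathbb{P}[M(X')\in S]+\delta$. The output space may contain, besides points of $\mathbb{R}^d$, additional special symbols. The constant in $O(\cdot)$ is absolute. *)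

(* Defs.v *)
From HB Require Import structures.
From mathcomp Require Import all_boot all_order all_algebra.
From mathcomp Require Import all_classical all_reals all_analysis.
Set Implicit Arguments.
Unset Strict Implicit.
Unset Printing Implicit Defensive.
Import Order.TTheory GRing.Theory Num.Theory.
Import numFieldNormedType.Exports.
Local Open Scope classical_set_scope.
Local Open Scope ring_scope.

Definition option_display : measure_display -> measure_display.
Proof. exact. Qed.

(* [None] is a special symbol adjoined to [T]; its singleton is measurable. *)
Section measurable_option.
Context {d} {T : measurableType d}.

Definition option_measurable : set (set (option T)) :=
  [set A | measurable (Some @^-1` A)].

Let option_set0 : option_measurable set0.
Proof. by rewrite /option_measurable /= preimage_set0. Qed.

Let option_setC A : option_measurable A -> option_measurable (~` A).
Proof. by rewrite /option_measurable /= preimage_setC => /measurableC. Qed.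

Let option_bigcup (F : (set (option T))^nat) :
  (forall i, option_measurable (F i)) -> option_measurable (\bigcup_i F i).
Proof.
move=> mF; rewrite /option_measurable /= preimage_bigcup.
by apply: bigcup_measurable => i _; exact: mF.
Qed.

HB.instance Definition _ := @isMeasurable.Build (option_display d) (option T)
  option_measurable option_set0 option_setC option_bigcup.

End measurable_option.

(* Points of R^d are [d.-tuple R] with the product (i.e. Borel)
   sigma-algebra: the norm that the library puts on row vectors is the sup
   norm, and row vectors carry no sigma-algebra. *)
Definition l2dist (R : realType) (d : nat) (x y : d.-tuple R) : R :=
  Num.sqrt (\sum_(i < d) (tnth x i - tnth y i) ^+ 2).

Definition neighboring (T : eqType) (n : nat) (X X' : n.-tuple T) : Prop :=
  #|[pred i | tnth X i != tnth X' i]| = 1%N.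

(* A randomized algorithm is a probability kernel [M]: [M X S] is the
   probability that the output on the dataset [X] lies in [S]. *)
Definition diff_private (R : realType) (n : nat) (d1 d2 : measure_display)
    (T : measurableType d1) (Y : measurableType d2) (eps delta : R)
    (M : R.-pker (n.-tuple T) ~> Y) : Prop :=
  forall X X' : n.-tuple T, neighboring X X' ->
  forall S : set Y, measurable S ->
    (M X S <= (expR eps)%:E * M X' S + delta%:E)%E.

(* Main.v *)
(* Round the data to the lattice of mesh [r / (d+1)]. A lattice point [p] votes for
   the set [blob p] of pairs [(y, t)] with [t < g (y - p)^2], where [g] is a product
   of tents of width [O(d)] (in mesh units); as [g] is Lipschitz in each coordinate,
   the Hellinger distance of two translates of [g^2] is controlled by the Euclidean
   length of the translation, so the blobs of points at distance [O(r)] overlap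
   almost entirely although a blob has Euclidean radius only [O(r sqrt d)].
   A pair with [s] votes gets weight [f s / |blob|], the symbol [None] gets a
   weight [nu] depending on the number of close pairs of data points, and one samples
   from the normalized weights. Both [f] and [nu] climb from [0] to [1]
   exponentially, so that a unit change of the argument costs a factor
   [exp (eps / 2)] and an additive [delta ^ 6]. As [f] vanishes up to [n / 3]
   votes, double counting bounds the total additive error by [O(delta ^ 6)], and a
   pair that can be output has the vote of a point of the good ball. The total weight is
   at least [1 / 20]: if [nu < 1] then some point is close to [0.42 n] others,
   hence many pairs of its blob get more than [n / 3 + L] votes. *)
Require Import Defs.
From HB Require Import structures.
From mathcomp Require Import all_boot all_order all_algebra.
From mathcomp Require Import finmap.
From mathcomp Require Import all_classical all_reals all_analysis.
From mathcomp Require Import measurable_realfun ring lra zify.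
Set Implicit Arguments.
Unset Strict Implicit.
Unset Printing Implicit Defensive.
Import Order.TTheory GRing.Theory Num.Theory.
Import numFieldNormedType.Exports.
Local Open Scope classical_set_scope.
Local Open Scope ring_scope.

(** * Weights *)

(** [E] and [b] are the multiplicative and additive costs of a unit change of the argument. Asking
    the last clause for all [s <= s' + 1] covers changes in both directions. *)
Definition is_ramp (R : realType) (E b a L : R) (f : R -> R) :=
  [/\ forall s, 0 <= f s <= 1, forall s, s <= a -> f s = 0,
    forall s, a + L <= s -> f s = 1 &
    forall s s', s <= s' + 1 -> f s <= E * f s' + b].

Lemma expR_le2 (R : realType) (e : R) : e <= 1 / 2 -> expR e <= 2.
Proof.
move=> e2; have := expR_ge1Dx (- e); rewrite expRN => h.
have h2 : 1 / 2 <= (expR e)^-1 by lra.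
by rewrite -(invrK (2 : R)) -[expR e]invrK lef_pV2 ?posrE ?invr_gt0 ?expR_gt0//; lra.
Qed.

(** The recurrence [u (s + 1) = expR e * u s + b] with [u a = 0] has the solution
    [c * (expR (e * (s - a)) - 1)]; truncation to [0, 1] keeps the step inequality. *)
Lemma exists_ramp (R : realType) (e b L a : R) :
  0 < e -> e <= 1 / 2 -> 0 < b -> b <= 1 / 3 -> 2 / e * ln (1 / b) <= L ->
  exists f, is_ramp (expR e) b a L f.
Proof.
move=> e0 e2 b0 b3 hL.
pose c := b / (expR e - 1).
have E1 : 1 < expR e by rewrite expR_gt1.
have E2 := expR_le2 e2.
have c0 : 0 < c by rewrite divr_gt0 ?subr_gt0.
pose u s := c * (expR (e * (s - a)) - 1).
have u_le s s' : s <= s' + 1 -> u s <= expR e * u s' + b.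
  move=> ss'.
  have -> : expR e * u s' + b = c * (expR (e * (s' + 1 - a)) - 1).
    have -> : e * (s' + 1 - a) = e + e * (s' - a) by ring.
    rewrite expRD /u /c; field; lra.
  rewrite ler_pM2l// lerB// ler_expR ler_pM2l//; lra.
exists (fun s => Num.max 0 (Num.min 1 (u s))); split.
- by move=> s; rewrite le_max lexx/= ge_max ler01/= ge_min lexx.
- move=> s sa; apply/max_idPl; rewrite ge_min; apply/orP; right.
  rewrite /u pmulr_rle0// subr_le0 -expR0 ler_expR pmulr_rle0//; lra.
- move=> s sL; rewrite (_ : Num.min 1 (u s) = 1) ?(max_idPr ler01)//.
  apply/min_idPl; rewrite /u.
  (* After the climb the exponential is at least [1 / b ^ 2]; as [expR e - 1 <= 1], it is enough
     that [1 / b - b >= 1]. *)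
  have h1 : ln (1 / b) *+ 2 <= e * (s - a).
    have -> : ln (1 / b) *+ 2 = e * (2 / e * ln (1 / b)) by field; lra.
    by rewrite ler_pM2l//; lra.
  have : expR (ln (1 / b) *+ 2) <= expR (e * (s - a)) by rewrite ler_expR.
  rewrite -mulr_natl expRM_natl lnK ?posrE ?divr_gt0// => h2.
  rewrite /c mulrAC ler_pdivlMr ?subr_gt0// mul1r.
  have h3 : b * ((1 / b) ^+ 2 - 1) <= b * (expR (e * (s - a)) - 1).
    by rewrite ler_pM2l// lerB.
  have h4 : b * ((1 / b) ^+ 2 - 1) = 1 / b - b by field; lra.
  have h5 : 3 <= 1 / b by rewrite ler_pdivlMr//; lra.
  lra.
- move=> s s' /u_le ule.
  have [h0|h0] := leP (u s') 0.
    have -> : Num.max 0 (Num.min 1 (u s')) = 0.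
      by apply/max_idPl; rewrite ge_min h0 orbT.
    rewrite mulr0 add0r ge_max (ltW b0)/= ge_min; apply/orP; right.
    apply: (le_trans ule); suff : expR e * u s' <= 0 by lra.
    by rewrite pmulr_rle0 ?expR_gt0.
  have [h1|h1] := leP 1 (u s').
    rewrite (max_idPr ler01) mulr1.
    have : Num.max 0 (Num.min 1 (u s)) <= 1 by rewrite ge_max ler01 ge_min lexx.
    lra.
  rewrite (max_idPr (ltW h0)) ge_max ge_min ule orbT andbT.
  have : 0 < expR e * u s' by rewrite mulr_gt0 ?expR_gt0.
  lra.
Qed.

Lemma sum_mem_fset (R : pzSemiRingType) (Z : choiceType) (B U : {fset Z}) (F : Z -> R) :
  (B `<=` U)%fset -> \sum_(z <- U) (z \in B)%:R * F z = \sum_(z <- B) F z.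
Proof.
move=> BU; rewrite -(big_fset_incl _ BU) => [|x _ /negbTE->]; last by rewrite mul0r.
by rewrite big_seq [RHS]big_seq; apply: eq_bigr => z ->; rewrite mul1r.
Qed.

Lemma sum1_fset (R : pzSemiRingType) (Z : choiceType) (B : {fset Z}) :
  \sum_(z <- B) 1 = #|` B|%:R :> R.
Proof. by rewrite big_const_seq count_predT iter_addr_0. Qed.

(** * Votes, close pairs and their sensitivity *)

Definition score (n : nat) (P : Type) (Z : choiceType) (A : P -> {fset Z})
  (X : 'I_n -> P) (z : Z) : nat := (\sum_(i < n) (z \in A (X i)))%N.

Definition close_pairs (n : nat) (P : Type) (near : rel P) (X : 'I_n -> P) : nat :=
  (\sum_(i < n) \sum_(j < n) near (X i) (X j))%N.

Definition candidates (n : nat) (P : Type) (Z : choiceType) (A : P -> {fset Z})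
  (X : 'I_n -> P) : {fset Z} := (\bigcup_(i <- enum 'I_n) A (X i))%fset.

(* [phi] is a test function on the outputs; [f] is applied to a score, and [nu] to
   minus the number of close pairs rescaled so as to have sensitivity 1. *)
Definition mass (R : realType) (n : nat) (P : Type) (Z : choiceType)
    (A : P -> {fset Z}) (near : rel P) (f nu : R -> R) (V : nat)
    (X : 'I_n -> P) (phi : option Z -> R) : R :=
  V%:R^-1 * (\sum_(z <- candidates A X) f (score A X z)%:R * phi (Some z))
  + nu (- ((close_pairs near X)%:R / (2 * n%:R))) * phi None.

Section candidates.
Context {n : nat} {P : Type} {Z : choiceType}.
Variables (A : P -> {fset Z}) (near : rel P).
Implicit Types (X : 'I_n -> P) (U : {fset Z}).
Local Notation score := (score A).
Local Notation candidates := (candidates A).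
Local Notation close_pairs := (close_pairs near).

Lemma score_le X z : (score X z <= n)%N.
Proof.
rewrite -[leqRHS]card_ord -sum1_card; apply: leq_sum => i _.
by case: (_ \in _).
Qed.

Lemma sub_candidates X i : (A (X i) `<=` candidates X)%fset.
Proof. by apply: (@bigfcup_sup _ _ _ i xpredT (fun i => A (X i))); rewrite ?mem_enum. Qed.

Lemma score_notin X z : z \notin candidates X -> score X z = 0%N.
Proof.
move=> zX; apply: big1 => i _; apply/eqP; rewrite eqb0; apply: contra zX.
exact/fsubsetP/sub_candidates.
Qed.

(** Double counting: every data point casts exactly [V] votes. *)
Lemma sum_score (R : realType) (V : nat) X U : (forall p, #|` A p| = V) ->
  (candidates X `<=` U)%fset -> \sum_(z <- U) (score X z)%:R = n%:R * V%:R :> R.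
Proof.
move=> AV XU; under eq_bigr do rewrite natr_sum.
rewrite exchange_big/= (eq_bigr (fun=> V%:R)) => [|i _].
  by rewrite sumr_const card_ord [RHS]mulr_natl.
rewrite -(AV (X i)) -sum1_fset -(sum_mem_fset _ (fsubset_trans (sub_candidates X i) XU)).
by apply: eq_bigr => z _; rewrite mulr1.
Qed.

Lemma score_sensitivity X X' k z : (forall i, i != k -> X i = X' i) ->
  (score X z <= score X' z + 1)%N.
Proof.
move=> XX'; rewrite /score (bigD1 k)//= [in leqRHS](bigD1 k)//=.
rewrite (eq_bigr (fun i => (z \in A (X' i)) : nat)) => [|i /XX' -> //].
by rewrite addnAC leq_add2r; case: (z \in A (X k)); rewrite ?addn1.
Qed.

(** Only pairs in the row or the column of [k] can change, which explains the factor [2 * n] in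
    [mass]. *)
Lemma close_pairs_sensitivity X X' k : (forall i, i != k -> X i = X' i) ->
  (close_pairs X <= close_pairs X' + 2 * n)%N.
Proof.
move=> XX'.
have h (i j : 'I_n) :
    (near (X i) (X j) <= near (X' i) (X' j) + ((i == k) + (j == k)))%N.
  have [->|/XX' ->] := eqVneq i k; first by case: near; case: near.
  have [->|/XX' ->] := eqVneq j k; first by case: near; case: near.
  by rewrite !addn0.
apply: (@leq_trans (\sum_(i < n) \sum_(j < n)
   (near (X' i) (X' j) + ((i == k) + (j == k))))%N).
  by apply: leq_sum => i _; apply: leq_sum => j _; exact: h.
have sk : (\sum_(i < n) (i == k) = 1)%N.
  by rewrite (bigD1 k)//= eqxx big1 ?addn0// => i /negbTE ->.
under eq_bigr do rewrite big_split.
rewrite big_split/= leq_add2l; under eq_bigr do rewrite big_split/= sk sum_nat_const card_ord.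
by rewrite big_split/= -big_distrr/= sk sum_nat_const card_ord; lia.
Qed.

(** Allows the masses of two datasets to be compared term by term over a common index set. *)
Lemma sum_candidates_ext (R : realType) (f : R -> R) X U (phi : Z -> R) : f 0 = 0 ->
  (candidates X `<=` U)%fset ->
  \sum_(z <- candidates X) f (score X z)%:R * phi z =
  \sum_(z <- U) f (score X z)%:R * phi z.
Proof.
by move=> f0 XU; apply: big_fset_incl => // z _ /score_notin ->; rewrite f0 mul0r.
Qed.

End candidates.

(** * The mass: monotonicity, change under one data point, lower bound *)

Lemma mass_ge0 (R : realType) (n : nat) (P : Type) (Z : choiceType)
    (A : P -> {fset Z}) (near : rel P) (f nu : R -> R) (V : nat)
    (X : 'I_n -> P) phi :
  (forall s, 0 <= f s <= 1) -> (forall s, 0 <= nu s <= 1) ->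
  (forall y, 0 <= phi y) -> 0 <= mass A near f nu V X phi.
Proof.
move=> f01 nu01 phi0; rewrite addr_ge0//.
  rewrite mulr_ge0// ?invr_ge0 ?ler0n// sumr_ge0// => z _.
  by rewrite mulr_ge0//; case/andP: (f01 (score A X z)%:R).
by rewrite mulr_ge0//; case/andP: (nu01 (- ((close_pairs near X)%:R / (2 * n%:R)))).
Qed.

Lemma mass_le (R : realType) (n : nat) (P : Type) (Z : choiceType)
    (A : P -> {fset Z}) (near : rel P) (f nu : R -> R) (V : nat)
    (X : 'I_n -> P) phi psi :
  (forall s, 0 <= f s <= 1) -> (forall s, 0 <= nu s <= 1) ->
  (forall y, phi y <= psi y) ->
  mass A near f nu V X phi <= mass A near f nu V X psi.
Proof.
move=> f01 nu01 h; rewrite lerD//.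
  rewrite ler_wpM2l// ?invr_ge0 ?ler0n// ler_sum// => z _.
  by rewrite ler_wpM2l//; case/andP: (f01 (score A X z)%:R).
by rewrite ler_wpM2l//; case/andP: (nu01 (- ((close_pairs near X)%:R / (2 * n%:R)))).
Qed.

(* A pair of positive weight has score above [n / 3], so that [b <= (3 b / n) score],
   and the scores add up to [n V]. *)
Lemma mass_step (R : realType) (n : nat) (P : Type) (Z : choiceType)
    (A : P -> {fset Z}) (near : rel P) (f nu : R -> R) (V : nat) (E b L : R)
    (X X' : 'I_n -> P) k phi :
  (0 < n)%N -> (0 < V)%N -> 0 <= E -> 0 <= b -> (forall p, #|` A p| = V) ->
  is_ramp E b (n%:R / 3) L f -> is_ramp E b (- (2 / 9 * n%:R)) L nu ->
  (forall i, i != k -> X i = X' i) ->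
  (forall y, 0 <= phi y <= 1) ->
  mass A near f nu V X phi <= E * mass A near f nu V X' phi + 4 * b.
Proof.
move=> n_gt0 V_gt0 E_ge0 b_ge0 cardA [f01 f_eq0 _ f_step] [_ _ _ nu_step] XX' phi01.
have n0 : 0 < n%:R :> R by rewrite ltr0n.
have V0 : 0 < V%:R :> R by rewrite ltr0n.
have f0 : f 0 = 0 by apply: f_eq0; rewrite divr_ge0.
pose U := (candidates A X `|` candidates A X')%fset.
have XU : (candidates A X `<=` U)%fset by exact: fsubsetUl.
have X'U : (candidates A X' `<=` U)%fset by exact: fsubsetUr.
rewrite /mass (sum_candidates_ext _ f0 XU) (sum_candidates_ext _ f0 X'U).
set q := - (_ / _); set q' := - (_ / _).
have hq : nu q <= E * nu q' + b.
  apply: nu_step; rewrite /q /q' -lerBlDl opprK addrC -lerBrDr opprK.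
  rewrite -[leRHS](mulfK (_ : 2 * n%:R != 0)) ?mulf_neq0 ?gt_eqF// ler_pM2r ?invr_gt0 ?mulr_gt0//.
  rewrite mulrDl mul1r divfK ?mulf_neq0 ?gt_eqF// -natrM -natrD ler_nat addnC.
  by apply: (@close_pairs_sensitivity _ _ _ _ _ k) => i /XX'.
have hf z : f (score A X z)%:R * phi (Some z) <=
    E * (f (score A X' z)%:R * phi (Some z)) + 3 * b / n%:R * (score A X z)%:R.
  have /andP[p0 p1] := phi01 (Some z).
  have h0 : 0 <= f (score A X' z)%:R by case/andP: (f01 (score A X' z)%:R).
  have [/f_eq0 ->|hs] := leP (score A X z)%:R (n%:R / 3 : R).
    by rewrite mul0r addr_ge0// !mulr_ge0// ?invr_ge0// ltW.
  have h1 : f (score A X z)%:R <= E * f (score A X' z)%:R + b.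
    by apply: f_step; rewrite natr1 ler_nat -addn1 (score_sensitivity _ _ XX').
  have h2 : b <= 3 * b / n%:R * (score A X z)%:R.
    have -> : 3 * b / n%:R * (score A X z)%:R = b * ((score A X z)%:R / (n%:R / 3)).
      by field; rewrite gt_eqF.
    by rewrite ler_peMr// ler_pdivlMr ?divr_gt0// mul1r ltW.
  have h3 : b * phi (Some z) <= b by rewrite ler_piMr.
  have h4 := ler_wpM2r p0 h1.
  by rewrite mulrDl -mulrA in h4; lra.
(* The errors add up to [3 * b * V]; dividing by [V] and adding the [b] of the symbol [None] gives
   [4 * b]. *)
have hS : \sum_(z <- U) f (score A X z)%:R * phi (Some z) <=
    E * (\sum_(z <- U) f (score A X' z)%:R * phi (Some z)) + 3 * b * V%:R.
  have -> : 3 * b * V%:R = 3 * b / n%:R * (n%:R * V%:R) by field; rewrite gt_eqF.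
  rewrite -(sum_score R cardA XU) !mulr_sumr -big_split/=.
  by apply: ler_sum => z _; exact: hf.
have Vi : 0 < V%:R^-1 :> R by rewrite invr_gt0.
have := ler_wpM2l (ltW Vi) hS; rewrite mulrDr [_ * (3 * b * _)]mulrC mulfK ?gt_eqF// => h1.
have /andP[p0 p1] := phi01 None.
have := ler_wpM2r p0 hq; rewrite mulrDl => h2.
have h3 : b * phi None <= b by rewrite ler_piMr.
move: V%:R^-1 h1 => c; lra.
Qed.

(** Either [None] has weight 1, or by averaging some blob meets many others almost entirely, so that
    its average score is well above [n / 3 + L]. *)
Lemma mass_total_ge (R : realType) (n : nat) (P : Type) (Z : choiceType)
    (A : P -> {fset Z}) (near : rel P) (f nu : R -> R) (V : nat) (E b L : R)
    (X : 'I_n -> P) :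
  (0 < n)%N -> (0 < V)%N -> 0 <= L -> L <= n%:R / 100 -> (forall p, #|` A p| = V) ->
  (forall p q, near p q -> 24 / 25 * V%:R <= #|` A p `&` A q|%fset%:R :> R) ->
  is_ramp E b (n%:R / 3) L f -> is_ramp E b (- (2 / 9 * n%:R)) L nu ->
  1 / 20 <= mass A near f nu V X (fun=> 1).
Proof.
move=> n_gt0 V_gt0 L_ge0 L_small cardA overlap [f01 f_eq0 f_eq1 _] [nu01 _ nu_eq1 _].
have n0 : 0 < n%:R :> R by rewrite ltr0n.
have V0 : 0 < V%:R :> R by rewrite ltr0n.
have f0 : f 0 = 0 by apply: f_eq0; rewrite divr_ge0.
set q := (close_pairs near X)%:R / (2 * n%:R) : R.
have [hq|hq] := leP (- (2 / 9 * n%:R) + L) (- q).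
  rewrite /mass -/q (nu_eq1 _ hq) mulr1 -[leLHS]add0r lerD//; last by lra.
  rewrite mulr_ge0// ?invr_ge0 ?ler0n// sumr_ge0// => z _.
  by rewrite mulr1; case/andP: (f01 (score A X z)%:R).
(* The number of pairs is [2 * n * q], and [2 * (2 / 9 - 1 / 100) > 21 / 50]. *)
have {}hq : 21 / 50 * n%:R * n%:R < (close_pairs near X)%:R :> R.
  have -> : (close_pairs near X)%:R = q * 2 * n%:R :> R by rewrite /q; field; rewrite gt_eqF.
  by rewrite ltr_pM2r//; lra.
have [i hi] : exists i, 21 / 50 * n%:R <= (\sum_(j < n) near (X i) (X j))%N%:R :> R.
  apply: contrapT => /forallNP h; have : (close_pairs near X)%:R <= 21 / 50 * n%:R * n%:R :> R.
    rewrite natr_sum; apply: (@le_trans _ _ (\sum_(i < n) 21 / 50 * n%:R)).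
      by apply: ler_sum => i _; apply/ltW; rewrite ltNge; apply/negP; exact: h.
    by rewrite sumr_const card_ord [leRHS]mulr_natr.
  by rewrite leNgt hq.
have sAi : 2 / 5 * n%:R * V%:R <= \sum_(z <- A (X i)) (score A X z)%:R :> R.
  under eq_bigr do rewrite natr_sum.
  rewrite exchange_big/=.
  apply: (@le_trans _ _ (\sum_(j < n) (near (X i) (X j))%:R * (24 / 25 * V%:R))).
    rewrite -mulr_suml -natr_sum mulrA ler_pM2r//.
    by rewrite (le_trans _ (ler_wpM2r _ hi))//; lra.
  apply: ler_sum => j _.
  have [nij|_] := boolP (near _ _); last by rewrite mul0r sumr_ge0.
  rewrite mul1r (le_trans (overlap _ _ nij))// -sum1_fset.
  rewrite -(sum_mem_fset _ (fsubsetIl _ _)).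
  rewrite big_seq [leRHS]big_seq; apply: ler_sum => z zi.
  by rewrite mulr1 inE zi.
(* A linear minorant of [f]: nonpositive before the end of the climb, at most 1 after it because
   scores are at most [n]. *)
have hf z : ((score A X z)%:R - (n%:R / 3 + L)) / n%:R <= f (score A X z)%:R.
  have [h|h] := leP (n%:R / 3 + L) (score A X z)%:R.
    rewrite f_eq1// ler_pdivrMr// mul1r.
    have : (score A X z)%:R <= n%:R :> R by rewrite ler_nat score_le.
    lra.
  have /andP[h0 _] := f01 (score A X z)%:R.
  by rewrite (le_trans _ h0)// pmulr_lle0 ?invr_gt0// subr_le0 ltW.
(* The margin is [2 / 5 - 1 / 3 - 1 / 100 > 1 / 20]. *)
have sf : V%:R / 20 <= \sum_(z <- A (X i)) f (score A X z)%:R.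
  apply: le_trans (ler_sum _ (fun z _ => hf z)).
  rewrite -mulr_suml sumrB -[X in _ - X](mulr1 _).
  have -> : \sum_(z <- A (X i)) (n%:R / 3 + L) = (n%:R / 3 + L) * V%:R.
    by rewrite -(cardA (X i)) -sum1_fset mulr_sumr; under [RHS]eq_bigr do rewrite mulr1.
  rewrite mulr1 ler_pdivlMr//.
  have : (n%:R / 3 + L) * V%:R <= (n%:R / 3 + n%:R / 100) * V%:R by rewrite ler_pM2r//; lra.
  have : 0 < n%:R * V%:R :> R by rewrite mulr_gt0.
  lra.
rewrite /mass (sum_candidates_ext _ f0 (fsubset_refl _)) -[leLHS]addr0 lerD//; last first.
  by rewrite mulr1; case/andP: (nu01 (- q)).
rewrite [leRHS]mulrC ler_pdivlMr// mul1r mulrC (le_trans sf)//.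
rewrite -(sum_mem_fset _ (sub_candidates A X i)); apply: ler_sum => z _.
by rewrite mulr1 ler_piMl//; [case/andP: (f01 (score A X z)%:R)|case: (_ \in _)].
Qed.

(** * Lattice blobs *)

Definition tent (N : nat) (j : int) : nat := (N - `|j|)%N.

Definition pyramid (d N : nat) (u : {ffun 'I_d -> int}) : nat :=
  (\prod_(k < d) tent N (u k))%N.

(** A finite index set for the cube [-N, N]^d, which contains the support of [pyramid]; [offset]
    recentres it. *)
Definition box (d N : nat) := {ffun 'I_d -> 'I_(2 * N).+1}.

Definition offset (d N : nat) (u : box d N) : {ffun 'I_d -> int} :=
  [ffun k => (u k)%:Z - N%:Z].

Definition tent_sqnorm (N : nat) : nat :=
  (\sum_(j < (2 * N).+1) tent N (j%:Z - N%:Z)%R ^ 2)%N.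

Lemma sum_even (N : nat) (F : nat -> nat) :
  (\sum_(j < (2 * N).+1) F `|j%:Z - N%:Z|%N =
   \sum_(i < N.+1) F i + \sum_(i < N) F i.+1)%N.
Proof.
rewrite -(big_mkord xpredT (fun j => F `|j%:Z - N%:Z|%N)).
rewrite (@big_cat_nat _ _ _ N.+1)//=; last by lia.
congr (_ + _)%N.
  rewrite big_mkord (reindex_inj rev_ord_inj)/=; apply: eq_bigr => i _.
  by congr F; have := ltn_ord i; lia.
rewrite -{1}[N.+1]add0n big_addn big_mkord.
rewrite (_ : ((2 * N).+1 - N.+1)%N = N); last by lia.
by apply: eq_bigr => i _; congr F; lia.
Qed.

Lemma tent_sqnorm_ge (N : nat) : (N ^ 3 <= 3 * tent_sqnorm N)%N.
Proof.
rewrite /tent_sqnorm (sum_even N (fun i => (N - i) ^ 2)%N).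
suff : (N ^ 3 <= 3 * \sum_(i < N.+1) (N - i) ^ 2)%N by lia.
elim: N => [//|N IH]; rewrite big_ord_recl/= subn0.
under eq_bigr do rewrite /bump /= add1n subSS.
move: IH; set S := (\sum_(_ < _) _)%N; rewrite !expnS !expn0 => IH; nia.
Qed.

Lemma tent_sqnorm_gt0 (N : nat) : (0 < N)%N -> (0 < tent_sqnorm N)%N.
Proof.
move=> N0; rewrite -(@ltn_pmul2l 3)// muln0.
by apply: leq_trans (tent_sqnorm_ge N); rewrite expn_gt0 N0.
Qed.

Lemma sum_subn_le (K m : nat) : (2 * \sum_(i < K) (m - i) <= m * m.+1)%N.
Proof.
elim: K m => [|K IH] m; first by rewrite big_ord0.
rewrite big_ord_recl/= subn0.
under eq_bigr do rewrite /bump /= add1n.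
case: m => [|m]; first by rewrite big1// => i _; rewrite sub0n.
under eq_bigr do rewrite subSS.
have := IH m; set S := (\sum_(_ < _) _)%N; nia.
Qed.

(** [m ^ 2] is the sum of the triangular numbers of [m] and [m - 1], one for each side of the
    apex. *)
Lemma sum_subn_even_le (N m : nat) :
  (\sum_(j < (2 * N).+1) (m - `|j%:Z - N%:Z|) <= m ^ 2)%N.
Proof.
rewrite (sum_even N (fun i => m - i)%N); have := sum_subn_le N.+1 m.
case: m => [|m] h.
  by rewrite !big1// => i _; rewrite sub0n.
under [X in (_ + X)%N]eq_bigr do rewrite subSS.
have := sum_subn_le N m; move: h.
set S := (\sum_(_ < _) _)%N; set S' := (\sum_(_ < _) _)%N; nia.
Qed.

(* Averaging over the lags [v] and [- v], the only loss is the concavity defect of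
   the tent at its apex, supported in [|s| < |v|]. *)
Lemma tent_correlation (N : nat) (v : int) :
  (tent_sqnorm N <= \sum_(j < (2 * N).+1)
     tent N (j%:Z - N%:Z)%R * tent N (j%:Z - N%:Z + v)%R + N * `|v| ^ 2)%N.
Proof.
pose a (s : int) := tent N s.
pose s (j : 'I_(2 * N).+1) : int := j%:Z - N%:Z.
(* The tent is even, so reflecting the index exchanges the lags [v] and [- v]. *)
have sym : (\sum_j a (s j) * a (s j + v)%R = \sum_j a (s j) * a (s j - v)%R)%N.
  rewrite (reindex_inj rev_ord_inj); apply: eq_bigr => j _ /=.
  have -> : s (rev_ord j) = - s j by rewrite /s /=; have := ltn_ord j; lia.
  by congr (_ * _)%N; rewrite /a /tent; congr (_ - _)%N; lia.
have := sum_subn_even_le N `|v|%N => h.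
have : (2 * tent_sqnorm N <= \sum_j a (s j) * a (s j + v)%R +
   \sum_j a (s j) * a (s j - v)%R + 2 * N * \sum_j (`|v| - `|s j|))%N.
  rewrite /tent_sqnorm !big_distrr -!big_split/=; apply: leq_sum => j _.
  have h1 : (2 * a (s j) <= a (s j + v)%R + a (s j - v)%R + 2 * (`|v| - `|s j|))%N.
    by rewrite /a /tent /s; have := ltn_ord j; lia.
  have h2 : (a (s j) <= N)%N by rewrite /a /tent; lia.
  rewrite -/(a (s j)); nia.
rewrite -sym; move: h; rewrite -[(\sum_(j < _) (_ - _))%N]/(\sum_j (`|v| - `|s j|))%N.
rewrite -[(\sum_(j < _) (_ * _))%N]/(\sum_j a (s j) * a (s j + v)%R)%N.
move: (\sum_j _)%N (\sum_j _)%N => c c'; nia.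
Qed.

Lemma offset_inj (d N : nat) : injective (@offset d N).
Proof.
move=> u v /ffunP uv; apply/ffunP => k; apply/val_inj.
by have := uv k; rewrite !ffunE => /addIr [].
Qed.

Lemma pyramid_gt0P (d N : nat) (u : {ffun 'I_d -> int}) :
  (0 < pyramid N u)%N -> exists v : box d N, u = offset v.
Proof.
move=> u0; have h k : (`|u k|%N < N)%N.
  by move: u0; rewrite /pyramid (bigD1 k)//= muln_gt0 /tent subn_gt0 => /andP[].
exists [ffun k => inord `|(u k + N%:Z)%R|%N]; apply/ffunP => k; rewrite !ffunE inordK; have := h k; move: (u k) => x; lia.
Qed.

Lemma pyramid_le (d N : nat) (u : {ffun 'I_d -> int}) : (pyramid N u <= N ^ d)%N.
Proof.
rewrite -[X in (N ^ X)%N]card_ord -prod_nat_const; apply: leq_prod => k _.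
by rewrite leq_subr.
Qed.

(** * Correlations of pyramids in dimension [d] *)

Lemma pyramid_correlationE (d N : nat) (w : {ffun 'I_d -> int}) :
  (\sum_(u : box d N) pyramid N (offset u) * pyramid N (offset u + w)%R =
   \prod_(k < d) \sum_(j < (2 * N).+1)
     tent N (j%:Z - N%:Z)%R * tent N (j%:Z - N%:Z + w k)%R)%N.
Proof.
rewrite bigA_distr_bigA; apply: eq_bigr => u _; rewrite -big_split/=.
by apply: eq_bigr => k _; rewrite !ffunE.
Qed.

Lemma pyramid_sqnorm (d N : nat) :
  (\sum_(u : box d N) pyramid N (offset u) ^ 2 = tent_sqnorm N ^ d)%N.
Proof.
under eq_bigr do rewrite expnS expn1 -{2}[offset _]addr0.
rewrite pyramid_correlationE -[X in (_ ^ X)%N]card_ord -prod_nat_const.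
apply: eq_bigr => k _; apply: eq_bigr => j _.
by rewrite ffunE addr0 expnS expn1.
Qed.

(** The Weierstrass product inequality; the induction also carries that the product lies in
    [0, 1]. *)
Lemma prod_1B_ge (R : realDomainType) (I : finType) (x : I -> R) :
  (forall i, 0 <= x i <= 1) -> 1 - \sum_i x i <= \prod_i (1 - x i).
Proof.
move=> x01; suff : [/\ 1 - \sum_i x i <= \prod_i (1 - x i),
  0 <= \prod_i (1 - x i) & \prod_i (1 - x i) <= 1] by case.
elim/big_rec2: _ => [|i p s _ [h0 h1 h2]]; first by rewrite subr0 ler01.
by have /andP[x0 x1] := x01 i; split; nra.
Qed.

(** Since [N ^ 3 <= 3 * tent_sqnorm N], coordinate [k] loses at most the fraction
    [3 * |w k| ^ 2 / N ^ 2]. These losses add up over the coordinates to the squared Euclidean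
    length of [w]. *)
Lemma pyramid_correlation (R : realType) (d N : nat) (w : {ffun 'I_d -> int}) :
  (0 < N)%N -> (3 * \sum_(k < d) `|w k| ^ 2 <= N ^ 2)%N ->
  (1 - (3 * \sum_(k < d) `|w k| ^ 2)%N%:R / N%:R ^+ 2) * (tent_sqnorm N ^ d)%N%:R <=
  (\sum_(u : box d N) pyramid N (offset u) * pyramid N (offset u + w)%R)%N%:R :> R.
Proof.
move=> N0 hw.
have NR : 0 < N%:R ^+ 2 :> R by rewrite exprn_gt0// ltr0n.
pose x k : R := (3 * `|w k| ^ 2)%N%:R / N%:R ^+ 2.
have hwk k : (3 * `|w k| ^ 2 <= N ^ 2)%N.
  by apply: leq_trans hw; rewrite leq_mul2l/= (bigD1 k)//= leq_addr.
have x01 k : 0 <= x k <= 1.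
  by rewrite divr_ge0 ?(ltW NR)//= ler_pdivrMr// mul1r -natrX ler_nat.
have -> : (3 * \sum_(k < d) `|w k| ^ 2)%N%:R / N%:R ^+ 2 = \sum_k x k.
  by rewrite big_distrr/= natr_sum mulr_suml.
rewrite pyramid_correlationE natr_prod.
apply: le_trans (ler_wpM2r _ (prod_1B_ge x01)) _ => //.
have -> : (tent_sqnorm N ^ d)%N%:R = \prod_(k < d) (tent_sqnorm N)%:R :> R.
  by rewrite natrX prodr_const card_ord.
rewrite -big_split/=; apply: ler_prod => k _; apply/andP; split.
  by case/andP: (x01 k) => _; rewrite -subr_ge0 => h; rewrite mulr_ge0.
have := tent_correlation N (w k); rewrite -(ler_nat R) natrD.
have : N%:R * (`|w k| ^ 2)%N%:R <= x k * (tent_sqnorm N)%:R :> R.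
  rewrite /x mulrAC ler_pdivlMr// natrM [3%:R * _]mulrC -!mulrA [leLHS]mulrCA.
  rewrite ler_wpM2l// -exprS -natrX -natrM ler_nat; exact: tent_sqnorm_ge.
rewrite natrM; lra.
Qed.

(* The second component makes [blob] the region below the graph of [pyramid ^ 2]:
   overlaps of blobs are overlaps of the corresponding distributions. *)
Definition blob (d N : nat) (p : {ffun 'I_d -> int}) : {fset {ffun 'I_d -> int} * nat} :=
  [fset ((p + offset w.1)%R, nat_of_ord w.2) | w : box d N * 'I_((N ^ d) ^ 2)
    in [pred w : box d N * 'I_((N ^ d) ^ 2) | (w.2 < pyramid N (offset w.1) ^ 2)%N]]%fset.

Lemma mem_blob (d N : nat) (p : {ffun 'I_d -> int}) z :
  (z \in blob N p) = (z.2 < pyramid N (z.1 - p)%R ^ 2)%N.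
Proof.
apply/imfsetP/idP => /=.
  by case=> -[u t] /= h ->; rewrite /= addrAC subrr add0r.
case: z => y t /= h.
have [|u hu] := @pyramid_gt0P _ N (y - p).
  by rewrite -(ltn_exp2r _ _ (ltn0Sn 1)); apply: leq_ltn_trans h.
have tN : (t < (N ^ d) ^ 2)%N by apply: (leq_trans h); rewrite leq_exp2r// pyramid_le.
exists (u, Ordinal tN); first by rewrite unfold_in /= -hu.
by rewrite /= -hu addrC subrK.
Qed.

Lemma sum_blob (R : nmodType) (d N : nat) (p : {ffun 'I_d -> int}) (F : _ -> R) :
  \sum_(z <- blob N p) F z =
  \sum_(u : box d N) \sum_(t < (N ^ d) ^ 2 | (t < pyramid N (offset u) ^ 2)%N)
    F (p + offset u, nat_of_ord t).
Proof.
rewrite big_imfset/=; last first.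
  move=> [u t] [v t'] _ _ [/addrI/offset_inj -> h].
  by congr pair; apply/val_inj.
by rewrite pair_big_dep /= big_enum.
Qed.

Lemma sum1_ord_lt (B m : nat) : (m <= B)%N -> (\sum_(t < B | (t < m)%N) 1 = m)%N.
Proof. by move=> mB; rewrite -(big_ord_widen _ (fun=> 1%N) mB) sum1_card card_ord. Qed.

Lemma pyramid_sq_le (d N : nat) (u : {ffun 'I_d -> int}) :
  (pyramid N u ^ 2 <= (N ^ d) ^ 2)%N.
Proof. by rewrite leq_exp2r// pyramid_le. Qed.

(** Above each lattice point both blobs are initial segments of the naturals, so their intersection
    is the shorter one. *)
Lemma card_blobI (d N : nat) (p q : {ffun 'I_d -> int}) :
  (#|` blob N p `&` blob N q|%fset = \sum_(u : box d N)
     minn (pyramid N (offset u) ^ 2) (pyramid N (offset u + (p - q))%R ^ 2))%N.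
Proof.
rewrite -[LHS]natn -sum1_fset -(sum_mem_fset _ (fsubsetIl _ _)) sum_blob.
apply: eq_bigr => u _; rewrite -[RHS](@sum1_ord_lt ((N ^ d) ^ 2)); last first.
  by rewrite geq_min pyramid_sq_le.
rewrite [RHS]big_mkcond [LHS]big_mkcond; apply: eq_bigr => t _.
rewrite inE !mem_blob/= mulr1 leq_min.
rewrite [p + _]addrC addrK -addrA; case: ltnP => //= h.
by case: (_ < _)%N.
Qed.

Lemma card_blob (d N : nat) (p : {ffun 'I_d -> int}) :
  #|` blob N p| = (tent_sqnorm N ^ d)%N.
Proof.
rewrite -pyramid_sqnorm -{1}[blob N p]fsetIid card_blobI subrr.
by apply: eq_bigr => u _; rewrite addr0 minnn.
Qed.

(** Translation is injective and [pyramid] vanishes outside the box; only an inequality holds, as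
    the shifted box may miss part of the support. *)
Lemma pyramid_sqnorm_shift (d N : nat) (w : {ffun 'I_d -> int}) :
  (\sum_(u : box d N) pyramid N (offset u + w)%R ^ 2 <= tent_sqnorm N ^ d)%N.
Proof.
rewrite -pyramid_sqnorm.
apply: (@leq_trans (\sum_(u : box d N) \sum_(v : box d N)
    (offset v == offset u + w)%R * pyramid N (offset v) ^ 2)%N).
  apply: leq_sum => u _; case: (posnP (pyramid N (offset u + w))) => [->//|].
  move=> /pyramid_gt0P[v uv]; rewrite (bigD1 v)//= uv eqxx mul1n leq_addr//.
rewrite exchange_big/=; apply: leq_sum => v _; rewrite -big_distrl/=.
rewrite -[leqRHS]mul1n leq_mul2r; apply/orP; right.
have [/existsP[u /eqP uv]|/existsPn h] :=
    boolP [exists u : box d N, offset v == offset u + w].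
  rewrite (bigD1 u)//= big1 ?addn0 ?leq_b1// => u' u'u; apply/eqP; rewrite eqb0.
  by apply: contra u'u; rewrite uv => /eqP/addIr/offset_inj ->.
by rewrite big1// => u _; apply/eqP; rewrite eqb0.
Qed.

(* [min (a^2) (b^2) >= a^2 - a^2 / 50 - 50 (a - b)^2] pointwise, and the sum of
   [(a - b)^2] is controlled by the correlation. *)
Lemma blob_overlap (R : realType) (d N : nat) (p q : {ffun 'I_d -> int}) :
  (0 < N)%N -> (15000 * \sum_(k < d) `|(p - q)%R k| ^ 2 <= N ^ 2)%N ->
  24 / 25 * (tent_sqnorm N ^ d)%N%:R <= #|` blob N p `&` blob N q|%fset%:R :> R.
Proof.
move=> N0 hpq; set V := (tent_sqnorm N ^ d)%N; set w := p - q.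
have NR : 0 < N%:R ^+ 2 :> R by rewrite exprn_gt0// ltr0n.
pose a (u : box d N) : R := (pyramid N (offset u))%:R.
pose b (u : box d N) : R := (pyramid N (offset u + w))%:R.
pose x : R := (3 * \sum_(k < d) `|w k| ^ 2)%N%:R / N%:R ^+ 2.
have hx : 100 * x <= 1 / 50.
  rewrite /x mulrA ler_pdivrMr// -natrX -natrM.
  move: hpq; rewrite -(ler_nat R) !natrM -/w; lra.
have ab : (1 - x) * V%:R <= \sum_u a u * b u.
  under eq_bigr do rewrite -natrM; rewrite -natr_sum; apply: pyramid_correlation => //.
  by apply: leq_trans hpq; rewrite leq_mul2r orbT.
have aa : \sum_u a u ^+ 2 = V%:R.
  by under eq_bigr do rewrite -natrX; rewrite -natr_sum pyramid_sqnorm.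
have bb : \sum_u b u ^+ 2 <= V%:R.
  by under eq_bigr do rewrite -natrX; rewrite -natr_sum ler_nat pyramid_sqnorm_shift.
have V0 : 0 <= V%:R :> R by [].
rewrite card_blobI natr_sum.
(* The sum is at least [(49 / 50 - 100 * x) * V], and [x <= 1 / 5000]. *)
apply: (@le_trans _ _ (\sum_u (49 / 50 * a u ^+ 2 - 50 * (a u - b u) ^+ 2))).
  have -> : \sum_u (49 / 50 * a u ^+ 2 - 50 * (a u - b u) ^+ 2) =
      (49 / 50 - 50) * (\sum_u a u ^+ 2) - 50 * (\sum_u b u ^+ 2) +
      100 * \sum_u a u * b u.
    by rewrite !mulr_sumr -sumrB -big_split/=; apply: eq_bigr => u _; ring.
  rewrite aa; nra.
apply: ler_sum => u _.
have [h|h] := leqP (pyramid N (offset u) ^ 2) (pyramid N (offset u + w)%R ^ 2).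
  by rewrite natrX -/(a u); have := sqr_ge0 (a u); have := sqr_ge0 (a u - b u); lra.
(* With [t = a - b], the difference of the two sides is [(a - 50 * t) ^ 2 / 50 + t ^ 2]. *)
rewrite natrX -/(b u); have := sqr_ge0 (a u - 50 * (a u - b u)); nra.
Qed.

(** * Kernels through a countable quantization *)

Lemma exists_finite_measure (R : realType) (dY : measure_display)
    (Y : measurableType dY) (I : Type) (s : seq I) (w : I -> R) (y : I -> Y) :
  (forall i, 0 <= w i) ->
  exists m : {measure set Y -> \bar R},
    forall S, m S = (\sum_(i <- s) w i * \1_S (y i))%:E.
Proof.
move=> w0; elim: s => [|i s [m hm]].
  by exists mzero => S; rewrite big_nil.
exists (measure_add (mscale (NngNum (w0 i)) (dirac (y i))) m) => S.
by rewrite [LHS]measure_addE hm big_cons EFinD.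
Qed.

(** A map that factors through a countable type with measurable fibres is measurable: every preimage
    is a countable union of fibres. *)
Lemma exists_kernel (R : realType) (d1 d2 : measure_display)
    (T1 : measurableType d1) (T2 : measurableType d2) (D : countType)
    (rho : T1 -> D) (m : D -> {measure set T2 -> \bar R}) :
  (forall e, measurable (rho @^-1` [set e])) ->
  (forall e, m e setT = 1%E) ->
  exists M : R.-pker T1 ~> T2, forall x, M x = m (rho x).
Proof.
move=> mrho m1; pose k x := m (rho x).
have mk U : measurable U -> measurable_fun [set: T1] (k ^~ U).
  move=> mU _ B mB; rewrite setTI.
  rewrite (_ : _ @^-1` _ = \bigcup_e (rho @^-1` [set e] `&` [set x | B (m e U)])).
    apply: countable_bigcupT_measurable => // e; apply: measurableI => //.
    have [h|h] := pselect (B (m e U)).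
      by rewrite (_ : mkset _ = setT)//; apply/seteqP; split.
    by rewrite (_ : mkset _ = set0)//; apply/seteqP; split.
  by apply/seteqP; split=> [x Bx|x [e _ [/= <-]]//]; exists (rho x).
pose kK := @isKernel.Build _ _ _ _ R k mk.
pose kP := @Kernel_isProbability.Build _ _ _ _ R (HB.pack_for (R.-ker T1 ~> T2) k kK) (fun x => m1 (rho x)).
by exists (HB.pack_for (R.-pker T1 ~> T2) k kK kP).
Qed.

Definition quantize (R : realType) (n d : nat) (h : R)
    (X : n.-tuple (d.-tuple R)) : {ffun 'I_n -> {ffun 'I_d -> int}} :=
  [ffun i => [ffun k => Num.floor (tnth (tnth X i) k / h)]].

Lemma measurable_quantize (R : realType) (n d : nat) (h : R) e :
  0 < h -> measurable (@quantize R n d h @^-1` [set e]).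
Proof.
move=> h0.
rewrite (_ : _ @^-1` _ = \bigcap_(i in [set: 'I_n]) \bigcap_(k in [set: 'I_d])
   ((fun X : n.-tuple (d.-tuple R) => tnth (tnth X i) k) @^-1`
     `[(e i k)%:~R * h, (e i k + 1)%:~R * h[)).
  apply: fin_bigcap_measurable => // i _; apply: fin_bigcap_measurable => // k _.
  rewrite -[X in measurable X]setTI.
  have : measurable_fun setT (fun X : n.-tuple (d.-tuple R) => tnth (tnth X i) k).
    apply: (@measurableT_comp _ _ _ _ _ _ (fun x : d.-tuple R => tnth x k)) => //.
      exact: measurable_tnth.
    exact: measurable_tnth.
  by apply => //; exact: measurable_itv.
apply/seteqP; split=> [X <- i _ k _|X Xe] /=.
  by rewrite !ffunE/= in_itv/= -ler_pdivlMr// -ltr_pdivrMr// floor_itv.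
apply/ffunP => i; apply/ffunP => k; rewrite !ffunE; apply/eqP.
by rewrite floor_eq; have := Xe i Logic.I k Logic.I; rewrite /= in_itv/= -ler_pdivlMr// -ltr_pdivrMr.
Qed.

(** * Privacy and utility *)

(** Numerator and denominator each cost a factor [E] and an additive [D]; with [1 / m <= 20] and
    [E <= 2] the additive terms amount to [20 * D + 40 * D]. *)
Lemma ratio_step (R : realFieldType) (a m a' m' E D : R) :
  1 / 20 <= m -> 1 / 20 <= m' -> 0 <= a' -> a' <= m' -> 0 <= E -> E <= 2 ->
  0 <= D -> a <= E * a' + D -> m' <= E * m + D ->
  a / m <= E ^+ 2 * (a' / m') + 60 * D.
Proof.
move=> m20 m20' a0 am E0 E2 D0 ha hm.
have m0 : 0 < m by lra.
have m0' : 0 < m' by lra.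
have Dm : D / m <= 20 * D.
  by rewrite ler_pdivrMr// mulrAC ler_peMl//; lra.
have p0 : 0 <= a' / m' by rewrite divr_ge0// ltW.
have p1 : a' / m' <= 1 by rewrite ler_pdivrMr// mul1r.
have h1 : a / m <= E * (a' / m) + D / m.
  by rewrite mulrA -mulrDl ler_pM2r ?invr_gt0.
have h2 : m' / m <= E + D / m.
  by rewrite ler_pdivrMr// mulrDl divfK ?gt_eqF.
have h3 : a' / m <= E * (a' / m') + 20 * D.
  have -> : a' / m = a' / m' * (m' / m) by rewrite mulrA divfK ?gt_eqF.
  have := ler_wpM2l p0 h2; nra.
have h4 : E * (a' / m) <= E * (E * (a' / m') + 20 * D) by rewrite ler_wpM2l.
have h5 : E * (20 * D) <= 40 * D by nra.
move: (a' / m') (a' / m) (a / m) (D / m) p0 p1 h1 h2 h3 h4 Dm => p q s t p0 p1 h1 h2 h3 h4 Dm.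
rewrite expr2; lra.
Qed.

(** * Geometry of rounded points *)

Lemma l2dist_le (R : realType) (d : nat) (x y : d.-tuple R) (r : R) : 0 <= r ->
  (l2dist x y <= r) = (\sum_(i < d) (tnth x i - tnth y i) ^+ 2 <= r ^+ 2).
Proof.
move=> r0; have s0 : 0 <= \sum_(i < d) (tnth x i - tnth y i) ^+ 2.
  by apply: sumr_ge0 => i _; exact: sqr_ge0.
by rewrite /l2dist -[in RHS](sqr_sqrtr s0) ler_sqr// nnegrE// sqrtr_ge0.
Qed.

Lemma neighboringP (T : eqType) (n : nat) (X X' : n.-tuple T) :
  neighboring X X' -> exists k, forall i, i != k -> tnth X i = tnth X' i.
Proof.
move=> /mem_card1[k hk]; exists k => i ik; apply/eqP/negPn.
by have := hk i; rewrite !inE (negbTE ik) => ->.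
Qed.

(* The constant 15000 is what [blob_overlap] needs for an overlap of 24/25 when the
   tents have half-width [500 (d+1)]. The factor [d+1] avoids a division by [0] in the
   mesh [r / (d+1)]. *)
Definition near_pts (d : nat) (p q : {ffun 'I_d -> int}) : bool :=
  (15000 * \sum_(k < d) `|(p - q)%R k| ^ 2 <= (500 * d.+1) ^ 2)%N.

Definition unquantize (R : realType) (d : nat) (h : R)
    (z : {ffun 'I_d -> int} * nat) : d.-tuple R :=
  [tuple (z.1 k)%:~R * h | k < d].

Lemma floorB_sqr_le (R : realType) (a b : R) :
  ((Num.floor a - Num.floor b)%:~R) ^+ 2 <= 2 * (a - b) ^+ 2 + 2.
Proof.
have /andP[a1 a2] := floor_itv a; have /andP[b1 b2] := floor_itv b.
rewrite intrD in a2; rewrite intrD in b2; rewrite intrB.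
move: (Num.floor a)%:~R (Num.floor b)%:~R a1 a2 b1 b2 => u v a1 a2 b1 b2.
have := sqr_ge0 (a - b - 1); have := sqr_ge0 (a - b + 1).
nra.
Qed.

(** In mesh units two points of the ball have squared distance at most [4 * (d + 1) ^ 2], which
    rounding raises to at most [8 * (d + 1) ^ 2 + 2 * d]. *)
Lemma near_quantize (R : realType) (n d : nat) (r : R)
    (X : n.-tuple (d.-tuple R)) (x : d.-tuple R) i j : 0 < r ->
  l2dist (tnth X i) x <= r -> l2dist (tnth X j) x <= r ->
  near_pts (quantize (r / d.+1%:R) X i) (quantize (r / d.+1%:R) X j).
Proof.
move=> r0; rewrite !l2dist_le ?(ltW r0)// => hi hj.
set h := r / d.+1%:R.
have d0 : 0 < d.+1%:R :> R by rewrite ltr0n.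
have h0 : 0 < h by rewrite divr_gt0.
rewrite /near_pts -(ler_nat R) natrM natr_sum natrX.
have -> : \sum_(k < d) (`|(quantize h X i - quantize h X j)%R k| ^ 2)%N%:R =
   \sum_(k < d) ((Num.floor (tnth (tnth X i) k / h) -
                  Num.floor (tnth (tnth X j) k / h))%:~R) ^+ 2 :> R.
  apply: eq_bigr => k _; rewrite !ffunE natrX.
  by rewrite natr_absz intr_norm real_normK// num_real.
apply: (@le_trans _ _ (15000 * (\sum_(k < d) (4 / h ^+ 2 *
   (tnth (tnth X i) k - tnth x k) ^+ 2 + 4 / h ^+ 2 *
   (tnth (tnth X j) k - tnth x k) ^+ 2 + 2)))).
  rewrite ler_wpM2l//; apply: ler_sum => k _; apply: (le_trans (floorB_sqr_le _ _)).
  rewrite lerD2r; move: (tnth (tnth X i) k) (tnth (tnth X j) k) (tnth x k) => u v w.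
  have -> : 4 / h ^+ 2 * (u - w) ^+ 2 + 4 / h ^+ 2 * (v - w) ^+ 2 =
      (4 * ((u - w) ^+ 2 + (v - w) ^+ 2)) / h ^+ 2 by ring.
  rewrite -mulrBl exprMn exprVn mulrA ler_pM2r ?invr_gt0 ?exprn_gt0//.
  have := sqr_ge0 (u + v - 2 * w); nra.
rewrite !big_split/= -!mulr_sumr sumr_const card_ord.
have rh : r ^+ 2 / h ^+ 2 = d.+1%:R ^+ 2.
  by rewrite /h; field; rewrite !gt_eqF.
have H : 4 / h ^+ 2 * r ^+ 2 = 4 * d.+1%:R ^+ 2 by rewrite mulrAC -mulrA rh.
have c0 : 0 <= 4 / h ^+ 2 by rewrite divr_ge0// sqr_ge0.
have := ler_wpM2l c0 hi; have := ler_wpM2l c0 hj; rewrite H.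
rewrite natrM; have -> : d%:R = d.+1%:R - 1 :> R by rewrite -[d.+1]addn1 natrD addrK.
have : 1 <= d.+1%:R :> R by rewrite ler1n.
move: (_ * \sum_(k < d) (tnth (tnth X i) k - _) ^+ 2)
  (_ * \sum_(k < d) (tnth (tnth X j) k - _) ^+ 2) (d.+1%:R) => s t D; nra.
Qed.

Lemma blob_coord (R : realType) (d N : nat) (p : {ffun 'I_d -> int}) z k :
  z \in blob N p -> (z.1 k - p k)%:~R ^+ 2 <= N%:R ^+ 2 :> R.
Proof.
rewrite mem_blob => h; have [|v hv] := @pyramid_gt0P _ N (z.1 - p).
  by rewrite -(ltn_exp2r _ _ (ltn0Sn 1)); apply: leq_ltn_trans h.
have : z.1 k - p k = (z.1 - p) k by rewrite !ffunE.
rewrite hv ffunE => ->.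
rewrite intrB -!pmulrn; have := ltn_ord (v k); rewrite ltnS -(ler_nat R) natrM.
have : 0 <= (v k)%:R :> R by [].
move: (v k)%:R N%:R => a b; nra.
Qed.

(** Each coordinate moves by at most [N] mesh steps in the blob and one more by rounding, hence by
    [501 * r]; summing squares yields the factor [sqrt d]. *)
Lemma unquantize_close (R : realType) (n d : nat) (r : R)
    (X : n.-tuple (d.-tuple R)) (x : d.-tuple R) i z : 0 < r ->
  l2dist (tnth X i) x <= r ->
  z \in blob (500 * d.+1) (quantize (r / d.+1%:R) X i) ->
  l2dist (unquantize (r / d.+1%:R) z) x <= 1000 * (r * Num.sqrt d%:R).
Proof.
move=> r0 + hz; set h := r / d.+1%:R; set N := (500 * d.+1)%N.
have K0 : 0 <= 1000 * (r * Num.sqrt d%:R).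
  by rewrite mulr_ge0 ?ler0n// mulr_ge0 ?sqrtr_ge0 ?ltW.
rewrite (l2dist_le _ _ (ltW r0)) (l2dist_le _ _ K0) => hx.

have d1 : 0 < d.+1%:R :> R by rewrite ltr0n.
have h0 : 0 < h by rewrite divr_gt0.
(* For [d = 0] both sides vanish; [d >= 1] is used to absorb the term [2 * r ^ 2] into a multiple of
   [r ^ 2 * d]. *)
have [d0|dpos] := posnP d.
  by rewrite big1 ?sqr_ge0// => k _; have := ltn_ord k; lia.
rewrite exprMn exprMn (sqr_sqrtr (ler0n _ _)).
have hN : h * (N%:R + 1) <= 501 * r.
  have -> : h * (N%:R + 1) = r * ((N%:R + 1) / d.+1%:R) by rewrite /h mulrAC mulrA.
  rewrite [leRHS]mulrC ler_pM2l// ler_pdivrMr// /N natrM.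
  have : 1 <= d.+1%:R :> R by rewrite ler1n.
  lra.
apply: (@le_trans _ _ (\sum_(k < d) (2 * (501 * r) ^+ 2 +
    2 * (tnth (tnth X i) k - tnth x k) ^+ 2))).
  apply: ler_sum => k _.
  rewrite tnth_mktuple.
  have := blob_coord R k hz; rewrite !ffunE intrB => hc.
  set t := tnth (tnth X i) k in hc *.
  have := floor_itv (t / h); rewrite intrD => /andP[f1 f2].
  have hc' : `|(z.1 k)%:~R - (Num.floor (t / h))%:~R| <= N%:R :> R.
    by rewrite -ler_sqr ?nnegrE// real_normK ?num_real.
  have ht : `|(z.1 k)%:~R - t / h| <= N%:R + 1.
    move: hc'; rewrite !ler_norml; lra.
  have ht' : `|(z.1 k)%:~R * h - t| <= 501 * r.
    apply: le_trans hN.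
    have -> : (z.1 k)%:~R * h - t = h * ((z.1 k)%:~R - t / h) by field; rewrite gt_eqF.
    by rewrite normrM gtr0_norm// ler_pM2l.
  have ht2 : ((z.1 k)%:~R * h - t) ^+ 2 <= (501 * r) ^+ 2.
    have r5 : 0 <= 501 * r by lra.
    by rewrite -real_normK ?num_real// ler_sqr ?nnegrE.
  move: ((z.1 k)%:~R * h) (tnth x k) ht2 => a b ht2.
  have := sqr_ge0 (a - t - (t - b)); nra.
rewrite big_split/= sumr_const card_ord -[_ *+ d]mulr_natr -[X in _ + X]mulr_sumr.
have : 1 <= d%:R :> R by rewrite ler1n.
have : 0 <= r ^+ 2 by exact: sqr_ge0.
rewrite exprMn; move: (\sum_(_ < _) _) (r ^+ 2) (d%:R : R) hx => s q D hx q0 D1.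
have : q <= q * D by rewrite ler_peMr.
lra.
Qed.

Lemma exists_normalized_mass (R : realType) (n : nat) (P : Type) (Z : choiceType)
    (A : P -> {fset Z}) (near : rel P) (f nu : R -> R) (V : nat)
    (X : 'I_n -> P) (dY : measure_display) (Y : measurableType dY)
    (out : option Z -> Y) :
  (forall s, 0 <= f s <= 1) -> (forall s, 0 <= nu s <= 1) ->
  exists m : {measure set Y -> \bar R}, forall S,
    m S = (mass A near f nu V X (fun o => \1_S (out o)) /
           mass A near f nu V X (fun=> 1))%:E.
Proof.
move=> f01 nu01; set T := mass A near f nu V X (fun=> 1).
have T0 : 0 <= T by apply: mass_ge0.
pose w o : R := (if o is Some z then V%:R^-1 * f (score A X z)%:R
  else nu (- ((close_pairs near X)%:R / (2 * n%:R)))) / T.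
have w0 o : 0 <= w o.
  rewrite divr_ge0//; case: o => [z|].
    by rewrite mulr_ge0 ?invr_ge0//; case/andP: (f01 (score A X z)%:R).
  by case/andP: (nu01 (- ((close_pairs near X)%:R / (2 * n%:R)))).
have [m hm] := @exists_finite_measure R _ Y _ (None :: map Some (candidates A X)) w out w0.
exists m => S; rewrite hm; congr EFin.
rewrite big_cons big_map /mass mulrDl [RHS]addrC; congr (_ + _).
  by rewrite /w mulrAC.
rewrite [_ / T]mulrC !mulr_sumr; apply: eq_bigr => z _; rewrite /w; ring.
Qed.

(** The good ball supplies at least [(2 / 3 * n) ^ 2] close pairs, which after rescaling is exactly
    where [nu] vanishes. At most [n / 3] points lie outside the ball, so a pair of positive weight
    has a vote from inside it. *)
Lemma mass_eq1 (R : realType) (n d : nat) (r L b E : R) (f nu : R -> R) (V : nat)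
    (X : n.-tuple (d.-tuple R)) (x : d.-tuple R) (phi : option _ -> R) :
  0 < r -> (0 < n)%N ->
  is_ramp E b (n%:R / 3) L f -> is_ramp E b (- (2 / 9 * n%:R)) L nu ->
  2 / 3 * n%:R <= #|[pred i | l2dist (tnth X i) x <= r]|%:R :> R ->
  (forall z, l2dist (unquantize (r / d.+1%:R) z) x <= 1000 * (r * Num.sqrt d%:R) ->
     phi (Some z) = 1) ->
  let e := quantize (r / d.+1%:R) X in
  mass (blob (500 * d.+1)) (@near_pts d) f nu V e phi =
  mass (blob (500 * d.+1)) (@near_pts d) f nu V e (fun=> 1).
Proof.
move=> r0 n0 [_ f0 _ _] [_ nu0 _ _] hG hphi e.
set G := [pred i | _] in hG.
have n0' : 0 < n%:R :> R by rewrite ltr0n.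
have Gsum : (\sum_(i < n) (i \in G : nat) = #|G|)%N.
  by rewrite -sum1_card [RHS]big_mkcond/=; apply: eq_bigr => i _; case: (_ \in _).
rewrite /mass; congr (_ * _ + _); last first.
  rewrite nu0 ?mul0r// lerN2 ler_pdivlMr ?mulr_gt0//.
  apply: (@le_trans _ _ (#|G|%:R * #|G|%:R)).
    have := ler_pM (_ : 0 <= 2 / 3 * n%:R) (_ : 0 <= 2 / 3 * n%:R) hG hG.
    by rewrite !mulr_ge0// => /(_ isT isT); apply: le_trans; lra.
  rewrite -natrM ler_nat -Gsum big_distrl/=; apply: leq_sum => i _.
  rewrite big_distrr/=; apply: leq_sum => j _.
  have [|] := boolP (i \in G); last by [].
  have [|] := boolP (j \in G); last by [].
  by rewrite !inE => hj hi; rewrite (near_quantize r0 hi hj).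
apply: eq_bigr => z _.
have [/f0 ->|hs] := leP (score (blob (500 * d.+1)) e z)%:R (n%:R / 3 : R).
  by rewrite !mul0r.
congr (_ * _); apply: hphi.
suff [i iG zi] : exists2 i, i \in G & z \in blob (500 * d.+1) (e i).
  by apply: unquantize_close zi.
apply: contrapT => /forall2NP hn.
have : (score (blob (500 * d.+1)) e z + #|G| <= n)%N.
  rewrite -Gsum -big_split/= -[leqRHS]card_ord -sum1_card.
  apply: leq_sum => i _; have [hi|] := hn i.
    by rewrite (negbTE (introN idP hi)) addn0; case: (_ \in _).
  by move=> /negP/negbTE ->; case: (_ \in _).
rewrite -(ler_nat R) natrD; lra.
Qed.

Theorem theorem1 (R : realType) :
  exists C K : R, 0 < C /\ 0 < K /\
  forall (eps delta : R),
    0 < eps -> eps <= 1 / 3 -> 0 < delta -> delta <= 1 / 3 ->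
  forall n : nat, C * (1 / eps * ln (1 / delta)) <= n%:R ->
  forall (d : nat) (r : R), 0 < r ->
  exists M : R.-pker (n.-tuple (d.-tuple R)) ~> (option (d.-tuple R)),
    diff_private eps delta M /\
    forall (X : n.-tuple (d.-tuple R)) (x : d.-tuple R),
      2 / 3 * n%:R <= #|[pred i | l2dist (tnth X i) x <= r]|%:R :> R ->
      M X [set y | exists2 x', y = Some x' &
                     l2dist x' x <= K * (r * Num.sqrt d%:R)] = 1%E.
Proof.
(* The climb length is [L = 24 / eps * ln (1 / delta)], and [L <= n / 100] requires [24 * 100]. *)
exists 2400, 1000; split; [by rewrite ltr0n|split; first by rewrite ltr0n].
move=> eps delta eps0 eps3 delta0 delta3 n hn d r r0.
have lnd : 0 < ln (1 / delta) by rewrite ln_gt0// ltr_pdivlMr//; lra.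
have n0 : (0 < n)%N.
  by rewrite -(ltr0n R); apply: lt_le_trans hn; rewrite mulr_gt0 ?ltr0n// mulr_gt0// divr_gt0.
(* Normalization squares the factor [expR e], hence the half; the sixth power works because
   [delta ^ 5 <= 1 / 243] and the additive loss is [240 * b]. *)
pose e := eps / 2; pose b := delta ^+ 6.
have e0 : 0 < e by rewrite /e; lra.
have e2 : e <= 1 / 2 by rewrite /e; lra.
have b0 : 0 < b by rewrite exprn_gt0.
have bd : 60 * (4 * b) <= delta.
  have d2 : delta ^+ 2 <= 1 / 9 by nra.
  have d4 : delta ^+ 4 <= 1 / 81 by rewrite (exprM _ 2 2); have := sqr_ge0 delta; nra.
  have d40 : 0 <= delta ^+ 4 by rewrite exprn_ge0 // ltW.
  have d5 : delta ^+ 5 <= 1 / 243 by rewrite exprS; nra.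
  rewrite /b exprSr; nra.
have b3 : b <= 1 / 3 by lra.
pose L := 2 / e * ln (1 / b).
have LE : L = 24 * (1 / eps * ln (1 / delta)).
  rewrite /L; have -> : 1 / b = (1 / delta) ^+ 6 by rewrite !div1r exprVn.
  rewrite lnXn ?divr_gt0// -mulr_natl /e; field; lra.
have L0 : 0 <= L by rewrite LE mulr_ge0 ?ler0n// mulr_ge0 ?divr_ge0// ltW.
have L100 : L <= n%:R / 100 by rewrite LE; lra.
have [f framp] := @exists_ramp R e b L (n%:R / 3) e0 e2 b0 b3 (lexx _).
have [nu nuramp] := @exists_ramp R e b L (- (2 / 9 * n%:R)) e0 e2 b0 b3 (lexx _).
have [f01 _ _ _] := framp; have [nu01 _ _ _] := nuramp.
set N := (500 * d.+1)%N; pose V := (tent_sqnorm N ^ d)%N.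
have N0 : (0 < N)%N by rewrite /N muln_gt0.
have V0 : (0 < V)%N.
  by rewrite expn_gt0 tent_sqnorm_gt0.
have cardV := @card_blob d N.
have overlap (p q : {ffun 'I_d -> int}) : near_pts p q ->
    24 / 25 * V%:R <= #|` blob N p `&` blob N q|%fset%:R :> R.
  exact: blob_overlap.
pose h := r / d.+1%:R.
have h0 : 0 < h by rewrite divr_gt0.
pose out := omap (unquantize h : _ -> d.-tuple R).
pose mu (c : {ffun 'I_n -> {ffun 'I_d -> int}}) := mass (blob N) (@near_pts d) f nu V c.
have /choice[m hm] : forall c : {ffun 'I_n -> {ffun 'I_d -> int}},
    exists m : {measure set (option (d.-tuple R)) -> \bar R},
      forall S, m S = (mu c (fun o => \1_S (out o)) / mu c (fun=> 1))%:E.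
  by move=> c; exact: exists_normalized_mass.
have mu20 c : 1 / 20 <= mu c (fun=> 1) by exact: (mass_total_ge _ n0 V0 L0 L100 cardV overlap framp nuramp).
have m1 c : m c setT = 1%E.
  rewrite hm; under eq_fun do rewrite indicT.
  by rewrite divff// gt_eqF// (lt_le_trans _ (mu20 c)).
have [M hM] := exists_kernel (fun c => @measurable_quantize R n d h c h0) m1.
exists M; split=> [X X' /neighboringP[k XX'] S _|X x hX].
  rewrite !hM !hm -EFinM -EFinD lee_fin.
  set c := quantize h X; set c' := quantize h X'.
  have cc' i : i != k -> c i = c' i.
    by move=> /XX' ik; apply/ffunP => j; rewrite !ffunE ik.
  have c'c i : i != k -> c' i = c i by move=> /cc' ->.
  have E0 : 0 <= expR e by exact: expR_ge0.
  have E2 := expR_le2 e2.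
  have ind01 (y : option _) : 0 <= (\1_S (out y) : R) <= 1.
    by rewrite indicE; case: (_ \in _); rewrite ?ler01 ?lexx.
  have -> : expR eps = expR e ^+ 2 by rewrite -expRM_natl /e; congr expR; field.
  have h1 := mass_step (@near_pts d) n0 V0 E0 (ltW b0) cardV framp nuramp cc' ind01.
  (* The normalizing constant is the mass of the test function 1, with the two datasets
     exchanged. *)
  have h2 : mu c' (fun=> 1) <= expR e * mu c (fun=> 1) + 4 * b.
    by apply: (mass_step (@near_pts d) n0 V0 E0 (ltW b0) cardV framp nuramp c'c) => y; rewrite ler01 lexx.
  have h3 : 0 <= mu c' (fun o => \1_S (out o)).
    by apply: mass_ge0 => // y; case/andP: (ind01 y).
  have h4 : mu c' (fun o => \1_S (out o)) <= mu c' (fun=> 1).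
    by apply: mass_le => // y; case/andP: (ind01 y).
  have b4 : 0 <= 4 * b by rewrite mulr_ge0// ltW.
  apply: le_trans (ratio_step (mu20 c) (mu20 c') h3 h4 E0 E2 b4 h1 h2) _.
  by rewrite lerD2l.
rewrite hM hm [mu _ (fun o => _)](mass_eq1 V r0 n0 framp nuramp hX) => [|z hz].
  by rewrite divff// gt_eqF// (lt_le_trans _ (mu20 _)).
by rewrite indicE mem_set//; exists (unquantize h z).
Qed.
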